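(* Let $k$ be a field, let $\sigma$ be an automorphism of $k$ that is not the identity map, and let $D = k((\sigma;x))$ be the skew Laurent series division ring over $k$. Then every element of $D$ can be expressed as a product of two commutators; that is, for every $f\in D$ there exist $p,q,r,t\in D$ such that $f=[p,q]\,[r,t]$.
   Context: For elements $a,b$ of a ring, the commutator is $[a,b]=ab-ba$. The skew Laurent series division ring $k((\sigma;x))$ consists of all formal Laurent series $\sum_{i=s}^{\infty}a_i x^i$ with $s\in\mathbb{Z}$ and $a_i\in k$ for $i\ge s$, with the usual addition and with multiplication determined by the rule $x^i a=\sigma^i(a)x^i$ for all $a\in k$, $i\in\mathbb{Z}$, where $\sigma^i$ denotes the $i$-th iterate of $\sigma$. Thus $\left(\sum_i a_i x^i\right)\left(\sum_j b_j x^j\right)=\sum_m\left(\sum_{i+j=m}a_i\sigma^i(b_j)\right)x^m$. *)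

(* Defs.v *)
From HB Require Import structures.
From mathcomp Require Import all_boot all_order all_algebra zify.
From mathcomp Require Import boolp classical_sets functions cardinality fsbigop.

Set Implicit Arguments.
Unset Strict Implicit.
Unset Printing Implicit Defensive.

Import Order.TTheory GRing.Theory Num.Theory.
Local Open Scope ring_scope.

Definition commutator (R : pzRingType) (a b : R) : R := a * b - b * a.

Section AutPow.
Variables (k : fieldType) (sigma : {rmorphism k -> k}).
Hypothesis sigma_bij : bijective sigma.

Lemma aut_surj (a : k) : exists b, sigma b == a.
Proof. by case: sigma_bij => g _ gK; exists (g a); rewrite gK. Qed.

Definition aut_inv (a : k) : k := xchoose (aut_surj a).

Definition aut_pow (i : int) : k -> k :=
  match i with
  | Posz n => iter n sigma
  | Negz n => iter n.+1 aut_inv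
  end.

Lemma aut_invK : cancel aut_inv sigma.
Proof. by move=> a; apply/eqP; exact: (xchooseP (aut_surj a)). Qed.

Lemma autK : cancel sigma aut_inv.
Proof. by move=> a; apply: (bij_inj sigma_bij); rewrite aut_invK. Qed.

Lemma aut_pow0 a : aut_pow 0 a = a. Proof. by []. Qed.

Lemma aut_powS i a : aut_pow (i + 1) a = sigma (aut_pow i a).
Proof.
case: i => [n|[|n]]; first by rewrite addrC -intS.
- by rewrite /= aut_invK.
have -> : Negz n.+1 + 1 = Negz n by lia.
by rewrite /= aut_invK.
Qed.

Lemma aut_powP i a : aut_pow (i - 1) a = aut_inv (aut_pow i a).
Proof. by rewrite -{2}(subrK 1 i) aut_powS autK. Qed.

Lemma aut_powD i j a : aut_pow (i + j) a = aut_pow i (aut_pow j a).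
Proof.
elim/int_rect: i => [|n IH|n IH]; first by rewrite add0r.
- have -> : n.+1%:Z + j = n%:Z + j + 1 by lia.
  have -> : n.+1%:Z = n%:Z + 1 by lia.
  by rewrite !aut_powS IH.
- have -> : - n.+1%:Z + j = - n%:Z + j - 1 by lia.
  have -> : - n.+1%:Z = - n%:Z - 1 by lia.
  by rewrite !aut_powP IH.
Qed.

Lemma aut_pow_ind (P : (k -> k) -> Prop) :
  P id -> (forall f, P f -> P (fun a => sigma (f a))) ->
  (forall f, P f -> P (fun a => aut_inv (f a))) -> forall i, P (aut_pow i).
Proof.
move=> P0 PS PV i; elim/int_rect: i => [//|n IH|n IH].
- have -> : aut_pow n.+1 = fun a => sigma (aut_pow n a) by [].
  exact: PS.
- have -> : aut_pow (- n.+1%:Z) = fun a => aut_inv (aut_pow (- n%:Z) a).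
    by apply: funext => a; rewrite -aut_powP; congr aut_pow; lia.
  exact: PV.
Qed.

Lemma aut_inv_inj : injective aut_inv. Proof. exact: can_inj aut_invK. Qed.

Lemma aut_invB : {morph aut_inv : a b / a - b}.
Proof. by move=> a b; apply: (bij_inj sigma_bij); rewrite rmorphB !aut_invK. Qed.

Lemma aut_invM : {morph aut_inv : a b / a * b}.
Proof. by move=> a b; apply: (bij_inj sigma_bij); rewrite rmorphM !aut_invK. Qed.

Lemma aut_inv1 : aut_inv 1 = 1.
Proof. by apply: (bij_inj sigma_bij); rewrite rmorph1 aut_invK. Qed.

Lemma aut_pow_zmod_morphism i : zmod_morphism (aut_pow i).
Proof.
elim/aut_pow_ind: (aut_pow i) => [//|f IH|f IH] a b.
- by rewrite IH rmorphB.
- by rewrite IH aut_invB.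
Qed.

Lemma aut_pow_monoid_morphism i : monoid_morphism (aut_pow i).
Proof.
elim/aut_pow_ind: (aut_pow i) => [//|f IH|f IH].
- by split=> [|a b]; rewrite IH ?rmorph1 ?rmorphM.
- by split=> [|a b]; rewrite IH ?aut_inv1 ?aut_invM.
Qed.

HB.instance Definition _ i :=
  GRing.isZmodMorphism.Build k k (aut_pow i) (aut_pow_zmod_morphism i).
HB.instance Definition _ i :=
  GRing.isMonoidMorphism.Build k k (aut_pow i) (aut_pow_monoid_morphism i).

End AutPow.

(* [mkSkewLaurent a _] stands for the series \sum_i a_i x^i. The type depends
   on sigma only through the multiplication. *)
Record skewLaurent (k : fieldType) (sigma : {rmorphism k -> k})
    (sigma_bij : bijective sigma) := mkSkewLaurent {
  slcoef :> int -> k;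
  slcoef_bounded : exists s : int, forall i : int, i < s -> slcoef i = 0
}.

Section Ring.
Variables (k : fieldType) (sigma : {rmorphism k -> k}).
Variable sigma_bij : bijective sigma.
Local Notation D := (skewLaurent sigma_bij).
Local Notation pow := (aut_pow sigma_bij).
Implicit Types (f g h : D) (i j m : int).

HB.instance Definition _ := gen_eqMixin D.
HB.instance Definition _ := gen_choiceMixin D.

Lemma slP f g : slcoef f =1 slcoef g -> f = g.
Proof.
case: f g => [a Ha] [b Hb] /= /funext ab; rewrite ab in Ha *.
by congr mkSkewLaurent; exact: Prop_irrelevance.
Qed.

Lemma sl_lower f :
  exists N : nat, forall i, i < - N%:Z -> f i = 0.
Proof.
by case: (slcoef_bounded f) => s Hs; exists `|s|%N => i Hi; apply: Hs; lia.
Qed.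

Lemma zero_bounded : exists s : int, forall i : int, i < s -> 0 = 0 :> k.
Proof. by exists 0. Qed.

Lemma opp_bounded f : exists s : int, forall i : int, i < s -> - f i = 0.
Proof.
by case: (slcoef_bounded f) => s Hs; exists s => i /Hs ->; rewrite oppr0.
Qed.

Lemma add_bounded f g : exists s : int, forall i : int, i < s -> f i + g i = 0.
Proof.
case: (sl_lower f) (sl_lower g) => [M HM] [N HN].
by exists (- (M + N)%N%:Z) => i Hi; rewrite HM ?HN ?addr0 //; lia.
Qed.

Lemma one_bounded :
  exists s : int, forall i : int, i < s -> (i == 0)%:R = 0 :> k.
Proof. by exists 0 => i Hi; rewrite lt_eqF. Qed.

(* The coefficient of x^m is a sum over all i : int of finite support. *)
Definition mul_coef (a b : int -> k) (m : int) : k :=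
  \sum_(i \in [set: int]) a i * pow i (b (m - i)).

Lemma mul_bounded f g : exists s : int, forall m : int, m < s -> mul_coef f g m = 0.
Proof.
case: (sl_lower f) (sl_lower g) => [M HM] [N HN].
exists (- (M + N)%N%:Z) => m Hm; apply: fsbig1 => i _.
have [Hi|Hi] := ltP i (- M%:Z); first by rewrite HM // mul0r.
by rewrite HN ?rmorph0 ?mulr0 //; lia.
Qed.

Definition sl_zero : D := mkSkewLaurent sigma_bij zero_bounded.
Definition sl_opp f : D := mkSkewLaurent sigma_bij (opp_bounded f).
Definition sl_add f g : D := mkSkewLaurent sigma_bij (add_bounded f g).
Definition sl_one : D := mkSkewLaurent sigma_bij one_bounded.
Definition sl_mul f g : D := mkSkewLaurent sigma_bij (mul_bounded f g).

Lemma sl_addA : associative sl_add.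
Proof. by move=> f g h; apply: slP => i /=; rewrite addrA. Qed.
Lemma sl_addC : commutative sl_add.
Proof. by move=> f g; apply: slP => i /=; rewrite addrC. Qed.
Lemma sl_add0 : left_id sl_zero sl_add.
Proof. by move=> f; apply: slP => i /=; rewrite add0r. Qed.
Lemma sl_addN : left_inverse sl_zero sl_opp sl_add.
Proof. by move=> f; apply: slP => i /=; rewrite addNr. Qed.

HB.instance Definition _ :=
  GRing.isZmodule.Build D sl_addA sl_addC sl_add0 sl_addN.

Definition window (N : nat) : seq int :=
  [seq n%:Z - N%:Z | n <- iota 0 (N + N).+1].

Lemma mem_window N i : (i \in window N) = (- N%:Z <= i <= N%:Z).
Proof.
apply/mapP/idP => [[n]|Hi]; first by rewrite mem_iota => ? ->; lia.
by exists (absz (i + N%:Z)); [rewrite mem_iota|]; lia.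
Qed.

Lemma window_uniq N : uniq (window N).
Proof. by rewrite map_inj_uniq ?iota_uniq // => m n; lia. Qed.

Lemma fsum_window N (F : int -> k) :
  (forall i, ~~ (- N%:Z <= i <= N%:Z) -> F i = 0) ->
  \sum_(i \in [set: int]) F i = \sum_(i <- window N) F i.
Proof.
move=> HF; rewrite (fsbigE (window N)) ?window_uniq //.
  by apply: eq_bigl => i; rewrite in_setT.
by move=> i _; rewrite mem_window; exact: HF.
Qed.

Lemma mul_coefE (N Nf Ng : nat) f g m :
  (forall i, i < - Nf%:Z -> f i = 0) -> (forall i, i < - Ng%:Z -> g i = 0) ->
  (Nf <= N)%N -> m + Ng%:Z <= N%:Z ->
  mul_coef f g m = \sum_(i <- window N) f i * pow i (g (m - i)).
Proof.
move=> Hf Hg HN Hm; apply: fsum_window => i Hi.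
have [Hi'|Hi'] := ltP i (- Nf%:Z); first by rewrite Hf // mul0r.
by rewrite Hg ?rmorph0 ?mulr0 //; lia.
Qed.

Lemma sl_mulDl : left_distributive sl_mul +%R.
Proof.
move=> f g h; apply: slP => m /=.
case: (sl_lower f) (sl_lower g) (sl_lower h) => [a Ha] [b Hb] [c Hc].
pose N := (a + b + c + `|m|)%N.
rewrite (@mul_coefE N (a + b) c (f + g) h) ?(@mul_coefE N a c f h)
  ?(@mul_coefE N b c g h) //; try lia.
  by rewrite -big_split; apply: eq_bigr => i _ /=; rewrite mulrDl.
by move=> i Hi /=; rewrite Ha ?Hb ?addr0 //; lia.
Qed.

Lemma sl_mulDr : right_distributive sl_mul +%R.
Proof.
move=> f g h; apply: slP => m /=.
case: (sl_lower f) (sl_lower g) (sl_lower h) => [a Ha] [b Hb] [c Hc].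
pose N := (a + b + c + `|m|)%N.
rewrite (@mul_coefE N a (b + c) f (g + h)) ?(@mul_coefE N a b f g)
  ?(@mul_coefE N a c f h) //; try lia.
  by rewrite -big_split; apply: eq_bigr => i _ /=; rewrite rmorphD mulrDr.
by move=> i Hi /=; rewrite Hb ?Hc ?addr0 //; lia.
Qed.

Lemma fsum_single j (F : int -> k) : (forall i, i != j -> F i = 0) ->
  \sum_(i \in [set: int]) F i = F j.
Proof.
move=> HF; rewrite (fsbigE [:: j]) //.
  by rewrite big_cons big_nil in_setT; exact: addr0.
by move=> i _; rewrite inE; exact: HF.
Qed.

Lemma fsum_shift j (F : int -> k) :
  \sum_(i \in [set: int]) F i = \sum_(i \in [set: int]) F (i + j).
Proof.
apply: (@reindex_fsbigT _ _ _ _ _ (fun i : int => i + j)).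
by exists (fun i => i - j) => i; rewrite ?addrK ?subrK.
Qed.

Lemma sl_mul1 : left_id sl_one sl_mul.
Proof.
move=> f; apply: slP => m /=.
rewrite /mul_coef (@fsum_single 0) /= ?mul1r ?subr0 //.
by move=> i /negPf ->; rewrite mul0r.
Qed.

Lemma sl_mulr1 : right_id sl_one sl_mul.
Proof.
move=> f; apply: slP => m /=.
rewrite /mul_coef (@fsum_single m) ?subrr ?rmorph1 ?mulr1 //.
by move=> i Hi; rewrite subr_eq0 eq_sym (negPf Hi) rmorph0 mulr0.
Qed.

Lemma sl_mulA : associative sl_mul.
Proof.
move=> f g h; apply: slP => m /=.
case: (sl_lower f) (sl_lower g) (sl_lower h) => [a Ha] [b Hb] [c Hc].
pose N := (a + b + c + `|m|)%N; pose M := (N + b)%N.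
have Hfg i : i < - (a + b)%N%:Z -> sl_mul f g i = 0.
  move=> Hi; apply: fsbig1 => j _.
  have [Hj|Hj] := ltP j (- a%:Z); first by rewrite Ha // mul0r.
  by rewrite Hb ?rmorph0 ?mulr0 //; lia.
have Hgh i : i < - (b + c)%N%:Z -> sl_mul g h i = 0.
  move=> Hi; apply: fsbig1 => j _.
  have [Hj|Hj] := ltP j (- b%:Z); first by rewrite Hb // mul0r.
  by rewrite Hc ?rmorph0 ?mulr0 //; lia.
rewrite (@mul_coefE M a (b + c) f (sl_mul g h)) //; try lia.
rewrite (@mul_coefE N (a + b) c (sl_mul f g) h) //; try lia.
transitivity (\sum_(i <- window N) \sum_(j <- window M)
   f j * (pow j (g (i - j)) * pow i (h (m - i)))); last first.
  rewrite big_seq [RHS]big_seq; apply: eq_bigr => i; rewrite mem_window => Hi.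
  rewrite /= (@mul_coefE M a b f g) //; try lia.
  by rewrite mulr_suml; apply: eq_bigr => j _; rewrite mulrA.
rewrite exchange_big; apply: eq_bigr => j _ /=.
have [Hj|Hj] := ltP j (- a%:Z).
  by rewrite Ha // mul0r big1 // => i _; rewrite mul0r.
rewrite -mulr_sumr; congr (_ * _).
rewrite -fsum_window; last first.
  move=> i Hi; have [Hi'|Hi'] := ltP (i - j) (- b%:Z).
    by rewrite Hb // rmorph0 mul0r.
  by rewrite Hc ?rmorph0 ?mulr0 //; lia.
rewrite (fsum_shift j).
rewrite (@fsum_window N); last first.
  move=> i Hi; have [Hi'|Hi'] := ltP i (- b%:Z).
    by rewrite addrK Hb // rmorph0 mul0r.
  by rewrite (Hc (m - _)) ?rmorph0 ?mulr0 //; lia.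
rewrite (@mul_coefE N b c g h) //; try lia.
rewrite rmorph_sum; apply: eq_bigr => i _.
by rewrite /= rmorphM /= -aut_powD addrK [i + j]addrC opprD addrA.
Qed.

Lemma sl_one_neq0 : sl_one != 0.
Proof.
apply/eqP => /(congr1 (fun f : D => f 0)) /= /eqP.
by rewrite oner_eq0.
Qed.

HB.instance Definition _ := GRing.Zmodule_isNzRing.Build D
  sl_mulA sl_mul1 sl_mulr1 sl_mulDl sl_mulDr sl_one_neq0.

End Ring.

(* Main.v *)
Require Import Defs.
From mathcomp Require Import all_boot all_order all_algebra.
From mathcomp Require Import zify ring boolp classical_sets fsbigop.

Set Implicit Arguments.
Unset Strict Implicit.
Unset Printing Implicit Defensive.

Import Order.TTheory GRing.Theory Num.Theory.
Local Open Scope ring_scope.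

(** The basic observation is that, for a constant a of k, the bracket [a, q]
    has coefficients (a - sigma^m(a)) q_m.  Hence every series whose support
    avoids the exponents m with sigma^m(a) = a is a commutator.  The proof
    factors f, of order s, as g c with both factors of this kind or close to it.

    A factorization f = g c with g of order l and c of order s - l is built one
    coefficient at a time: the coefficient of x^(s+n) contains the new unknowns
    g_(l+n) and c_(s-l+n) linearly with nonzero factors, so the equation is
    solvable as soon as one of the exponents l + n, s - l + n may be used
    ([factor_support]).  If both are forbidden, both are in the stabilizer of a,
    and so is their difference s - 2l.  This gives the factorization whenever
    none of l, s - l, s - 2l stabilizes a ([two_commutators_support]).
    The choice of l depends on how sigma acts ([orbit_cases]).

    - If some a has an orbit with more than four elements, then l = 1 or l = -1
      works ([two_commutators_long_orbit]).
    - Otherwise, if sigma^2 is not the identity, sigma has order 3 or 4 and some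
      b has an orbit of full length.  If sigma^s is the identity, l = 1 works.
      If not, let g have order s and c have order 0, with c_0 = sigma(b) - b and
      c_n = 0 for n > 0 with sigma^n = id.  Such a c is a commutator
      [x + ..., b x^-1 + ...], built again by recursion ([commutator_order0]):
      when sigma^n is not the identity the coefficient of x^n can be prescribed
      at will, and otherwise the error to be compensated is a sum of terms
      sigma^j(z) - z, which the bracket with x can absorb
      ([two_commutators_free_orbit]).
    - If sigma^2 is the identity, D is a quaternion algebra over its center.
      Write f = fe + fo with fe b = b fe and fo b = sigma(b) fo for b in k; two
      commutators are given explicitly in terms of fe, fo and their inverses
      ([two_commutators_involution]). *)

(** * Sequences defined by a recursive choice *)

Definition upd (T : Type) (w : nat -> T) (n : nat) (z : T) : nat -> T :=
  fun i => if i == n then z else w i.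

Arguments upd : simpl never.

Lemma upd_eq (T : Type) (w : nat -> T) n z : upd w n z n = z.
Proof. by rewrite /upd eqxx. Qed.

Lemma upd_lt (T : Type) (w : nat -> T) n z i : (i < n)%N -> upd w n z i = w i.
Proof. by rewrite /upd ltn_neqAle => /andP[/negPf ->]. Qed.

(** Dependent choice in the form in which series are constructed below: Q n stands
    for the equation between the coefficients of the n-th lowest degree. *)
Lemma recursive_choice (T : Type) (z0 : T) (Q : nat -> (nat -> T) -> Prop) :
  (forall n w w', (forall i, (i <= n)%N -> w i = w' i) -> Q n w -> Q n w') ->
  (forall n w, (forall i, (i < n)%N -> Q i w) -> exists z, Q n (upd w n z)) ->
  exists w, forall n, Q n w.
Proof.
move=> Qloc Qstep.
have /choice[c Hc] : forall a : nat * (nat -> T), exists z,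
    (forall i, (i < a.1)%N -> Q i a.2) -> Q a.1 (upd a.2 a.1 z).
  move=> -[n w] /=.
  have [/Qstep[z Hz]|H] := pselect (forall i, (i < n)%N -> Q i w).
    by exists z.
  by exists z0.
(* W n has its first n entries right, and later stages never change them. *)
pose W := fix W n := if n is m.+1 then upd (W m) m (c (m, W m)) else fun=> z0.
have Wext n d i : (i < n)%N -> W (d + n)%N i = W n i.
  by move=> Hi; elim: d => //= d IH; rewrite upd_lt ?IH //; lia.
exists (fun n => W n.+1 n).
have WQ n : forall i, (i < n)%N -> Q i (W n).
  elim: n => // n IH i; rewrite ltnS leq_eqVlt => /orP[/eqP ->|Hi].
    exact: (Hc (n, W n)).
  apply: Qloc (IH i Hi) => j Hj /=.
  by rewrite upd_lt //; lia.
move=> n; apply: Qloc (WQ n.+1 n (ltnSn n)) => i Hi.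
by rewrite -(Wext i.+1 (n - i)%N) //; congr (W _ _); lia.
Qed.

Arguments aut_pow : simpl never.

(** * Coefficients and orders of skew Laurent series *)

Section Series.
Variables (k : fieldType) (sigma : {rmorphism k -> k}).
Variable sigma_bij : bijective sigma.
Local Notation D := (skewLaurent sigma_bij).
Local Notation pow := (aut_pow sigma_bij).
Implicit Types (f g h c p q : D) (a b : k) (i j m s : int).

Lemma powK i : cancel (pow i) (pow (- i)).
Proof. by move=> a; rewrite -aut_powD addNr. Qed.

Lemma powVK i : cancel (pow (- i)) (pow i).
Proof. by move=> a; rewrite -aut_powD subrr. Qed.

Lemma fix_add i j a : pow i a = a -> pow j a = a -> pow (i + j) a = a.
Proof. by move=> Hi Hj; rewrite aut_powD Hj. Qed.

Lemma fix_opp i a : pow i a = a -> pow (- i) a = a.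
Proof. by move=> Hi; rewrite -[in LHS]Hi powK. Qed.

Lemma fix_sub i j a : pow i a = a -> pow j a = a -> pow (i - j) a = a.
Proof. by move=> Hi /fix_opp; apply: fix_add. Qed.

Lemma mulE f g m : (f * g) m = mul_coef sigma_bij f g m.
Proof. by []. Qed.

Lemma subE f g m : (f - g) m = f m - g m. Proof. by []. Qed.
Lemma oneE m : (1 : D) m = (m == 0)%:R. Proof. by []. Qed.
Lemma zeroE m : (0 : D) m = 0. Proof. by []. Qed.

Lemma mul_lowE f g i j (n : nat) :
  (forall m, m < i -> f m = 0) -> (forall m, m < j -> g m = 0) ->
  (f * g) (i + j + n%:Z) =
    \sum_(t < n.+1) f (i + t%:Z) * pow (i + t%:Z) (g (j + (n - t)%N%:Z)).
Proof.
move=> Hf Hg; rewrite mulE /mul_coef.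
have uniq_r : uniq [seq i + t%:Z | t <- iota 0 n.+1].
  by rewrite map_inj_uniq ?iota_uniq // => t t'; lia.
rewrite (fsbigE _ _ uniq_r) //; last first.
  move=> m _ Hm.
  have [Hi|Hi] := ltP m i; first by rewrite Hf // mul0r.
  have [Hj|Hj] := ltP (i + j + n%:Z - m) j.
    by rewrite Hg // rmorph0 mulr0.
  case/negP: Hm; apply/mapP; exists `|m - i|%N; last by lia.
  by rewrite mem_iota; lia.
rewrite big_map (_ : iota 0 n.+1 = index_iota 0 n.+1) //.
rewrite big_mkcond big_mkord.
apply: eq_bigr => t _; rewrite in_setT; congr (_ * pow _ (g _)).
by have := ltn_ord t; lia.
Qed.

Lemma mul_low0 f g i j :
  (forall m, m < i -> f m = 0) -> (forall m, m < j -> g m = 0) ->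
  forall m, m < i + j -> (f * g) m = 0.
Proof.
move=> Hf Hg m Hm; rewrite mulE /mul_coef fsbig1 // => l _.
have [Hi|Hi] := ltP l i; first by rewrite Hf // mul0r.
by rewrite Hg ?rmorph0 ?mulr0 //; lia.
Qed.

Lemma exists_order f : f <> 0 ->
  exists2 s, f s != 0 & forall m, m < s -> f m = 0.
Proof.
move=> f0; case: (slcoef_bounded f) => l Hl.
have ex : exists n : nat, f (l + n%:Z) != 0.
  apply: contrapT => H; apply: f0; apply: slP => m; rewrite zeroE.
  have [/Hl //|lm] := ltP m l.
  apply/eqP/negPn/negP => fm; apply: H; exists `|m - l|%N.
  by have -> : l + `|m - l|%N%:Z = m by lia.
exists (l + (ex_minn ex)%:Z); first by case: ex_minnP.
case: ex_minnP => n _ Hn m Hm.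
have [/Hl //|lm] := ltP m l.
apply/eqP/negPn/negP => fm.
have : (n <= `|m - l|)%N by apply: Hn; have -> : l + `|m - l|%N%:Z = m by lia.
by lia.
Qed.

Lemma series_bounded s (u : nat -> k) :
  exists l : int, forall i, i < l -> (if i < s then 0 else u `|i - s|%N) = 0.
Proof. by exists s => i ->. Qed.

Definition series s (u : nat -> k) : D :=
  mkSkewLaurent sigma_bij (series_bounded s u).

Lemma series_lt s u m : m < s -> series s u m = 0.
Proof. by move=> /= ->. Qed.

Lemma seriesE s u (n : nat) : series s u (s + n%:Z) = u n.
Proof.
rewrite /= ltNge (_ : s <= s + n%:Z) /=; last by lia.
by congr u; lia.
Qed.

Lemma series_mul s s' u v (n : nat) :
  (series s u * series s' v) (s + s' + n%:Z) =
  \sum_(t < n.+1) u t * pow (s + t%:Z) (v (n - t)%N).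
Proof.
rewrite mul_lowE; try by move=> m; apply: series_lt.
by apply: eq_bigr => t _; rewrite !seriesE.
Qed.

Lemma eq_from_order s f g : (forall m, m < s -> f m = 0) ->
  (forall m, m < s -> g m = 0) ->
  (forall n : nat, f (s + n%:Z) = g (s + n%:Z)) -> f = g.
Proof.
move=> Hf Hg H; apply: slP => m.
have [ms|sm] := ltP m s; first by rewrite Hf ?Hg.
by have := H `|m - s|%N; have -> : s + `|m - s|%N%:Z = m by lia.
Qed.

Definition cst a : D := series 0 (fun n => if n == 0%N then a else 0).

Lemma cstE a m : cst a m = if m == 0 then a else 0.
Proof. by case: m => [[|n]|n]. Qed.

Lemma cst_mulE a f m : (cst a * f) m = a * f m.
Proof.
rewrite mulE /mul_coef (@fsum_single _ 0) ?cstE ?subr0 // => i /negPf Hi.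
by rewrite cstE Hi mul0r.
Qed.

Lemma mul_cstE a f m : (f * cst a) m = f m * pow m a.
Proof.
rewrite mulE /mul_coef (@fsum_single _ m) ?cstE ?subrr ?eqxx // => i Hi.
by rewrite cstE subr_eq0 eq_sym (negPf Hi) rmorph0 mulr0.
Qed.

(** * Factorizations with prescribed supports *)

(** The equation (a - sigma^m(a)) q_m = g_m is solved by division, coefficient
    by coefficient. *)
Lemma commutator_support a g :
  (forall m, pow m a = a -> g m = 0) -> exists q, g = commutator (cst a) q.
Proof.
move=> Hg.
have bd : exists s : int, forall m, m < s -> (a - pow m a)^-1 * g m = 0.
  by case: (slcoef_bounded g) => s Hs; exists s => m /Hs ->; rewrite mulr0.
exists (mkSkewLaurent sigma_bij bd); apply: slP => m.
rewrite /commutator subE cst_mulE mul_cstE /=.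
rewrite [X in _ = _ - X]mulrC -mulrBl.
have [am|am] := eqVneq (a - pow m a) 0.
  by rewrite am mul0r Hg //; apply/esym/eqP; rewrite -subr_eq0 am.
by rewrite mulrA divff // mul1r.
Qed.

(** The unknowns at step n are g_(l+n) and c_(s-l+n).  In the coefficient of
    x^(s+n) they are multiplied by a twist of the leading coefficient of the
    other factor, so that one of them suffices to solve the equation. *)
Lemma factor_support (A B : int -> Prop) f s l (c0 : k) :
  f s != 0 -> (forall m, m < s -> f m = 0) ->
  A l -> B (s - l) -> c0 != 0 ->
  (forall n : nat, (0 < n)%N -> A (l + n%:Z) \/ B (s - l + n%:Z)) ->
  exists g c, [/\ f = g * c, forall m, ~ A m -> g m = 0,
    forall m, ~ B m -> c m = 0, c (s - l) = c0 &
    forall m, m < s - l -> c m = 0].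
Proof.
move=> fs flow Al Bl c0n0 AB.
pose Q (n : nat) (w : nat -> k * k) :=
  [/\ \sum_(t < n.+1) (w t).1 * pow (l + t%:Z) (w (n - t)%N).2 = f (s + n%:Z),
      ~ A (l + n%:Z) -> (w n).1 = 0, ~ B (s - l + n%:Z) -> (w n).2 = 0 &
      n = 0%N -> (w n).2 = c0].
have [w Hw] : exists w, forall n, Q n w.
  apply: (recursive_choice (0, 0)) => [n w w' ww' [H1 H2 H3 H4]|[|n] w Hw].
  - split; rewrite -?ww' //.
    by rewrite -H1; apply: eq_bigr => t _; rewrite !ww' ?leq_subr // -ltnS.
  - exists (f s / pow l c0, c0); split=> //; rewrite ?addr0 //.
    rewrite big_ord_recl big_ord0 /upd /= !addr0 mulfVK //.
    by rewrite fmorph_eq0.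
  have [] := Hw 0%N isT; rewrite big_ord_recl big_ord0 /= !addr0.
  move=> E0 _ _ /(_ erefl) Ec.
  have g0 : (w 0%N).1 != 0 by apply: contraNneq fs => E; rewrite -E0 E mul0r.
  (* The part of the equation that only involves earlier entries. *)
  pose r := f (s + n.+1%:Z) - \sum_(t < n) (w t.+1).1 *
              pow (l + t.+1%:Z) (w (n - t)%N).2.
  have eqn z1 z2 : z1 * pow (l + n.+1%:Z) c0 + (w 0%N).1 * pow l z2 = r ->
    \sum_(t < n.+2) (upd w n.+1 (z1, z2) t).1 * pow (l + t%:Z)
      (upd w n.+1 (z1, z2) (n.+1 - t)%N).2 = f (s + n.+1%:Z).
    rewrite /r => /eqP; rewrite eq_sym subr_eq => /eqP ->.
    rewrite big_ord_recl big_ord_recr /= /bump /= subn0 !add1n.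
    rewrite subnn upd_eq !(@upd_lt _ _ _ _ 0) // Ec addr0 addrCA addrC.
    congr (_ + _); first exact: addrC.
    apply: eq_bigr => t _; rewrite !add1n subSS.
    by have Ht := ltn_ord t; rewrite !upd_lt //; lia.
  have [An|nAn] := pselect (A (l + n.+1%:Z)).
    exists (r / pow (l + n.+1%:Z) c0, 0); split; rewrite ?upd_eq //.
    by apply: eqn; rewrite mulfVK ?fmorph_eq0 // rmorph0 mulr0 addr0.
  have Bn : B (s - l + n.+1%:Z) by case: (AB n.+1 isT).
  exists (0, pow (- l) (r / (w 0%N).1)); split; rewrite ?upd_eq //.
  by apply: eqn; rewrite mul0r add0r powVK mulrC mulfVK.
pose g := series l (fun n => (w n).1).
pose c := series (s - l) (fun n => (w n).2).
have supp (C : int -> Prop) i u : (forall n : nat, ~ C (i + n%:Z) -> u n = 0) ->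
    forall m, ~ C m -> series i u m = 0.
  move=> H m Cm; have [mi|im] := ltP m i; first exact: series_lt.
  have E : m = i + `|m - i|%N%:Z by lia.
  by rewrite E seriesE H // -E.
exists g, c; split.
- apply: (@eq_from_order s) => // [m Hm|n].
    by apply: mul_low0 (@series_lt _ _) (@series_lt _ _) _ _; lia.
  have <- : l + (s - l) + n%:Z = s + n%:Z by lia.
  by rewrite series_mul; case: (Hw n) => -> _ _ _; congr (f _); lia.
- by apply: supp => n; case: (Hw n).
- by apply: supp => n; case: (Hw n).
- by rewrite -[s - l]addr0 (seriesE _ _ 0); case: (Hw 0%N) => _ _ _ ->.
- exact: series_lt.
Qed.

Definition two_commutators f :=
  exists p q r t : D, f = commutator p q * commutator r t.

(** Exponents l + n and s - l + n that both stabilize a would have a difference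
    s - 2l that stabilizes a. *)
Lemma two_commutators_support f s l a :
  f s != 0 -> (forall m, m < s -> f m = 0) ->
  pow l a <> a -> pow (s - l) a <> a -> pow (s - l - l) a <> a ->
  two_commutators f.
Proof.
move=> fs flow al asl asll.
pose A m := pow m a <> a.
have [|g [c [-> gA cA _ _]]] :=
    @factor_support A A f s l 1 fs flow al asl (oner_neq0 _).
  move=> n _; have [|/contrapT fl] := pselect (A (l + n%:Z)); first by left.
  right=> fsl; apply: asll.
  have -> : s - l - l = s - l + n%:Z - (l + n%:Z) by lia.
  exact: fix_sub.
have [|q ->] := @commutator_support a g; first by move=> m am; apply: gA; apply.
have [|t ->] := @commutator_support a c; first by move=> m am; apply: cA; apply.
by exists (cst a), q, (cst a), t.
Qed.

(** The exponent l = 1 only fails when sigma^(s-1) or sigma^(s-2) fixes a.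
    If l = -1 failed as well, sigma^(s+1) or sigma^(s+2) would also fix a, and
    the difference, one of 2, 3 and 4, would be a stabilizing exponent. *)
Lemma two_commutators_long_orbit f s a :
  f s != 0 -> (forall m, m < s -> f m = 0) ->
  (forall n : nat, (0 < n < 5)%N -> pow n a <> a) -> two_commutators f.
Proof.
move=> fs flow aP.
have aN (n : nat) i : i = n%:Z \/ i = - n%:Z -> (0 < n < 5)%N -> pow i a <> a.
  move=> [->|->] Hn E; apply: (aP n) => //.
  by rewrite -[n%:Z]opprK; apply: fix_opp.
have [[] H|H] := pselect (pow (s - 1) a = a \/ pow (s - 1 - 1) a = a).
- apply: (two_commutators_support fs flow (l := -1) (a := a)).
  + by apply: (aN 1%N) => //; right.
  + move=> /fix_sub /(_ H); apply: (aN 2%N) => //; left; lia.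
  + move=> /fix_sub /(_ H); apply: (aN 3%N) => //; left; lia.
- apply: (two_commutators_support fs flow (l := -1) (a := a)).
  + by apply: (aN 1%N) => //; right.
  + move=> /fix_sub /(_ H); apply: (aN 3%N) => //; left; lia.
  + move=> /fix_sub /(_ H); apply: (aN 4%N) => //; left; lia.
- apply: (two_commutators_support fs flow (l := 1) (a := a)).
  + by apply: (aN 1%N) => //; left.
  + by move=> E; apply: H; left.
  + by move=> E; apply: H; right.
Qed.

(** * Commutators of order zero *)

Definition coboundary a := exists b, a = sigma b - b.

Lemma coboundaryD a b : coboundary a -> coboundary b -> coboundary (a + b).
Proof. by move=> [x ->] [y ->]; exists (x + y); rewrite rmorphD; ring. Qed.

Lemma coboundaryN a : coboundary a -> coboundary (- a).
Proof. by move=> [x ->]; exists (- x); rewrite rmorphN; ring. Qed.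

Lemma coboundary0 : coboundary 0.
Proof. by exists 0; rewrite rmorph0 subr0. Qed.

Lemma coboundary_pow i a : coboundary (pow i a - a).
Proof.
elim/int_rect: i => [|n IH|n IH]; first by rewrite subrr; exact: coboundary0.
- have -> : pow n.+1 a - a = (sigma (pow n a) - pow n a) + (pow n a - a).
    by rewrite subrKA.
  by apply: coboundaryD => //; exists (pow n a).
- have E : pow (- n%:Z) a = sigma (pow (- n.+1%:Z) a).
    by rewrite -aut_powS; congr (pow _ a); lia.
  have -> : pow (- n.+1%:Z) a - a =
      - (sigma (pow (- n.+1%:Z) a) - pow (- n.+1%:Z) a) + (pow (- n%:Z) a - a).
    by rewrite E; ring.
  by apply: coboundaryD => //; apply: coboundaryN; exists (pow (- n.+1%:Z) a).
Qed.

(** Here c = [p, q] with p = x + ... and q = b x^-1 + ..., where the new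
    unknowns z1 = p_(n+1) and z2 = q_(n-1) enter the coefficient of x^n through
    z1 sigma^(n+1)(b) - b sigma^-1(z1) + sigma(z2) - z2.  If sigma^n moves b,
    the choice z2 = - b sigma^-1(z1) turns this into z1 (sigma^(n+1)(b) - sigma(b)),
    which takes every value.  If sigma^n fixes b, it is the identity, and the
    terms p_i sigma^i(q_j) - q_j sigma^j(p_i) with i + j = n are coboundaries
    z - sigma^j(z) with z = p_i sigma^i(q_j); so z1 = 0 and a suitable z2 do. *)
Lemma commutator_order0 c b :
  (forall m, pow m b = b -> pow m =1 id) ->
  (forall m, m < 0 -> c m = 0) -> c 0 = sigma b - b ->
  (forall m, 0 < m -> pow m b = b -> c m = 0) ->
  exists p q, c = commutator p q.
Proof.
move=> bP clow c0 cfix.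
pose Q (n : nat) (w : nat -> k * k) :=
  \sum_(t < n.+1) ((w t).1 * pow (1 + t%:Z) (w (n - t)%N).2
    - (w (n - t)%N).2 * pow (-1 + (n - t)%N%:Z) (w t).1) = c n
  /\ (n = 0%N -> w n = (1, b)).
have [w Hw] : exists w, forall n, Q n w.
  apply: (recursive_choice (0, 0)) => [n w w' ww' [H1 H2]|[|n] w Hw].
  - split; rewrite -?ww' //.
    by rewrite -H1; apply: eq_bigr => t _; rewrite !ww' ?leq_subr // -ltnS.
  - exists (1, b); split=> //.
    by rewrite big_ord_recl big_ord0 upd_eq !addr0 c0 rmorph1 mulr1 mul1r.
  have [_ /(_ erefl) E0] := Hw 0%N isT.
  pose r := c n.+1 - \sum_(t < n)
    ((w t.+1).1 * pow (1 + t.+1%:Z) (w (n - t)%N).2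
    - (w (n - t)%N).2 * pow (-1 + (n - t)%N%:Z) (w t.+1).1).
  suff [z1 [z2 Ez]] : exists z1 z2,
      z1 * pow (1 + n.+1%:Z) b - b * pow (-1) z1 + (sigma z2 - z2) = r.
    exists (z1, z2); split=> //.
    move: Ez; rewrite /r => /eqP; rewrite eq_sym subr_eq => /eqP ->.
    rewrite big_ord_recl big_ord_recr /= /bump /= subn0 !add1n.
    rewrite subnn upd_eq !(@upd_lt _ _ _ _ 0) // E0 !addr0 /=.
    rewrite mul1r rmorph1 mulr1 addrCA addrC.
    congr (_ + _); first exact: addrC.
    apply: eq_bigr => t _; rewrite !add1n subSS.
    by have Ht := ltn_ord t; rewrite !upd_lt //; lia.
  have [fixn|nfix] := pselect (pow n.+1 b = b).
    suff [z Ez] : coboundary r.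
      by exists 0, z; rewrite rmorph0 mul0r mulr0 subr0 add0r Ez.
    rewrite /r cfix // sub0r; apply: coboundaryN.
    apply: (big_ind coboundary) => [||t _]; first exact: coboundary0.
      exact: coboundaryD.
    set x := (w _).1; set y := (w _).2.
    have E : pow (-1 + (n - t)%N%:Z) (x * pow (1 + t.+1%:Z) y) =
        pow (-1 + (n - t)%N%:Z) x * y.
      rewrite rmorphM /= -aut_powD (_ : _ + (1 + t.+1%:Z) = n.+1%:Z).
        by rewrite (bP _ fixn).
      by have := ltn_ord t; lia.
    rewrite [y * _]mulrC -E -opprB.
    by apply: coboundaryN; exact: coboundary_pow.
  pose d := pow (1 + n.+1%:Z) b - sigma b.
  have d0 : d != 0.
    rewrite subr_eq0; apply/eqP => E; apply: nfix.
    by apply: (bij_inj sigma_bij); rewrite -E aut_powD.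
  exists (r / d), (- (b * pow (-1) (r / d))).
  have : sigma (pow (-1) (r / d)) = r / d by rewrite -aut_powS.
  move: (pow (-1) (r / d)) => x E.
  by rewrite rmorphN rmorphM /= E -[RHS](mulfVK d0) /d; ring.
exists (series 1 (fun n => (w n).1)), (series (-1) (fun n => (w n).2)).
apply: (@eq_from_order 0) => // [m Hm|n].
  rewrite /commutator subE.
  by rewrite !(mul_low0 (@series_lt _ _) (@series_lt _ _)) ?subr0.
rewrite /commutator subE -{2}(subrr 1) series_mul.
rewrite -[0 + n%:Z]/(-1 + 1 + n%:Z) series_mul.
rewrite [X in _ - X](reindex_inj rev_ord_inj) /= -sumrB.
rewrite add0r -(proj1 (Hw n)); apply: eq_bigr => t _.
by rewrite subSS subKn // -ltnS.
Qed.

(** If sigma^s fixes b, hence is the identity, no exponent among 1, s - 1 and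
    s - 2 stabilizes b.  Otherwise g has order s and c order 0: whenever sigma^n
    fixes b, sigma^(s+n) moves it, so g can take over where c has to vanish. *)
Lemma two_commutators_free_orbit f s b :
  f s != 0 -> (forall m, m < s -> f m = 0) ->
  (forall m, pow m b = b -> pow m =1 id) -> pow 2 b <> b -> two_commutators f.
Proof.
move=> fs flow bP b2.
have b1 : pow 1 b <> b by move=> b1; apply: b2; exact: (fix_add b1 b1).
have [sb|sb] := pselect (pow s b = b).
  apply: (two_commutators_support fs flow (l := 1) (a := b)) => //.
  - by move=> /(fix_sub sb); rewrite opprB addrC subrK.
  - by move=> /(fix_sub sb); have -> : s - (s - 1 - 1) = 2 by lia.
pose B m := m = 0 \/ pow m b <> b.
have u0 : sigma b - b != 0 by rewrite subr_eq0; apply/eqP.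
have [||g [c [-> gA cB c0 clow]]] :=
    @factor_support (fun m => pow m b <> b) B f s s _ fs flow sb _ u0.
- by left; rewrite subrr.
- move=> n n0; rewrite subrr add0r.
  have [nb|nb] := pselect (pow n b = b); last by right; right.
  by left => /fix_sub /(_ nb); rewrite addrK.
rewrite subrr in c0 clow.
have [|q ->] := @commutator_support b g; first by move=> m bm; apply: gA; apply.
have [m m0 bm|r [t ->]] := commutator_order0 bP clow c0.
  by apply: cB => -[m00|//]; rewrite m00 in m0.
by exists (cst b), q, r, t.
Qed.

(** * Inverses *)

Lemma mulV_exists g : g <> 0 -> exists c, g * c = 1.
Proof.
move=> /exists_order[l gl glow].
pose Q (n : nat) (w : nat -> k) :=
  \sum_(t < n.+1) g (l + t%:Z) * pow (l + t%:Z) (w (n - t)%N) = (n == 0%N)%:R.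
have [w Hw] : exists w, forall n, Q n w.
  apply: (recursive_choice 0) => [n w w' ww'|n w _].
    by rewrite /Q => <-; apply: eq_bigr => t _; rewrite ww' ?leq_subr.
  pose r := (n == 0%N)%:R - \sum_(t < n) g (l + t.+1%:Z) *
     pow (l + t.+1%:Z) (w (n - t.+1)%N).
  exists (pow (- l) (r / g l)).
  rewrite /Q big_ord_recl /= subn0 upd_eq addr0 powVK mulrC mulfVK //.
  rewrite -[RHS](subrK (\sum_(t < n) g (l + t.+1%:Z) *
     pow (l + t.+1%:Z) (w (n - t.+1)%N))) -/r; congr (_ + _).
  apply: eq_bigr => t _; have := ltn_ord t; rewrite /bump /= add1n => Ht.
  by rewrite upd_lt //; lia.
exists (series (- l) w); apply: (@eq_from_order 0) => [m Hm|m Hm|n].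
- by apply: mul_low0 glow (@series_lt _ _) _ _; lia.
- by rewrite oneE lt_eqF.
rewrite -{1}(subrr l) mul_lowE //; last by move=> m; apply: series_lt.
rewrite add0r oneE -[n%:Z == 0]/(n == 0%N) -Hw.
by apply: eq_bigr => t _; rewrite seriesE.
Qed.

Lemma inverse_exists g : g <> 0 -> exists c, g * c = 1 /\ c * g = 1.
Proof.
move=> g0; have [c gc] := mulV_exists g0; exists c; split=> //.
have [|d cd] := @mulV_exists c.
  by move=> c0; move: gc; rewrite c0 mulr0 => /esym/eqP; rewrite oner_eq0.
by have -> : g = d by rewrite -[g]mulr1 -cd mulrA gc mul1r.
Qed.

(** * Involutions *)

Lemma cstB a b : cst (a - b) = cst a - cst b.
Proof. by apply: slP => m; rewrite subE !cstE; case: eqP; rewrite ?subr0. Qed.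

Lemma cstM a b : cst (a * b) = cst a * cst b.
Proof.
by apply: slP => m; rewrite cst_mulE !cstE; case: eqP; rewrite ?mulr0.
Qed.

Lemma cst1 : cst 1 = 1.
Proof. by apply: slP => m; rewrite cstE oneE; case: eqP. Qed.

Definition twisted g := forall b, g * cst b = cst (sigma b) * g.

(** Comparing coefficients, g_m (sigma^m(a) - sigma(a)) = 0; so an exponent that
    stabilizes a is outside the support of g. *)
Lemma twisted_commutator a g : sigma a <> a -> twisted g ->
  exists q, g = commutator (cst a) q.
Proof.
move=> sa gT; apply: commutator_support => m am.
have /(congr1 (fun h : D => h m)) := gT a.
rewrite mul_cstE cst_mulE am [RHS]mulrC => /eqP.
rewrite -subr_eq0 -mulrBr mulf_eq0 subr_eq0 => /orP[/eqP //|/eqP].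
by move/esym.
Qed.

Lemma twisted_inv p q : involutive sigma -> p * q = 1 -> q * p = 1 ->
  twisted p -> twisted q.
Proof.
move=> sK pq qp pT b; have := pT (sigma b); rewrite sK => E.
by rewrite -[LHS]mulr1 -pq mulrA -[q * _ * p]mulrA -E mulrA qp mul1r.
Qed.

Lemma twisted_commute_mul g h : twisted g ->
  (forall b, h * cst b = cst b * h) -> twisted (g * h).
Proof. by move=> gT hC b; rewrite -mulrA hC mulrA gT mulrA. Qed.

Lemma twisted_commutator_sub p q a : p * q = 1 -> q * p = 1 -> twisted p ->
  commutator p (cst (- a) * q) = cst (a - sigma a).
Proof.
move=> pq qp pT; rewrite /commutator mulrA pT -!mulrA pq qp !mulr1 -cstB.
by rewrite rmorphN; congr cst; ring.
Qed.

Lemma commutatorDr p q h :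
  commutator p (q + h) = commutator p q + commutator p h.
Proof. by rewrite /commutator mulrDr mulrDl opprD addrACA. Qed.

Definition variable : D := series 1 (fun n => (n == 0%N)%:R).

Lemma variable_twisted : twisted variable.
Proof.
move=> b; apply: slP => m; rewrite mul_cstE cst_mulE.
have [m1|m1] := ltP m 1; first by rewrite series_lt // mul0r mulr0.
have -> : m = 1 + `|m - 1|%N%:Z by lia.
by rewrite seriesE mulrC; case: `|m - 1|%N => [|n]; rewrite ?mulr0.
Qed.

Lemma variable_neq0 : variable <> 0.
Proof.
move/(congr1 (fun h : D => h 1)); rewrite -{1}[1]addr0 (seriesE 1 _ 0) zeroE.
by move/eqP; rewrite oner_eq0.
Qed.

Lemma pow_involutive m : involutive sigma -> pow m =1 id \/ pow m =1 sigma.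
Proof.
move=> sK.
have invE b : aut_inv sigma_bij b = sigma b.
  by rewrite -[in LHS](sK b) autK.
elim/int_rect: m => [|n IH|n IH]; first by left.
- have E b : pow n.+1 b = sigma (pow n b) by [].
  by case: IH => IH; [right|left] => b; rewrite E IH ?sK.
- have E b : pow (- n.+1%:Z) b = sigma (pow (- n%:Z) b).
    by rewrite -invE -aut_powP; congr (pow _ b); lia.
  by case: IH => IH; [right|left] => b; rewrite E IH ?sK.
Qed.

(** Split f = fe + fo, where fe commutes with k and fo is twisted.  If fo = 0,
    write f = x (x^-1 f); both factors are twisted.  If not, let
    u = a - sigma(a), g = fo u^-1 and p = fo^-1 fe.  Then g and p are twisted and
    f = g c with c = u p + u.  Since [p, -a] = u p and [p, -a p^-1] = u, the
    factor c is [p, -a - a p^-1]; when p = 0 it is [x, -a x^-1]. *)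
Lemma two_commutators_involution f a : involutive sigma -> sigma a <> a ->
  two_commutators f.
Proof.
move=> sK sa.
have bd : exists s : int, forall m, m < s ->
    (if pow m a == a then 0 else f m) = 0.
  by case: (slcoef_bounded f) => s Hs; exists s => m /Hs ->; case: ifP.
pose fo : D := mkSkewLaurent sigma_bij bd; pose fe := f - fo.
have foT : twisted fo.
  move=> b; apply: slP => m; rewrite mul_cstE cst_mulE /=.
  case: eqP => [|am]; first by rewrite mul0r mulr0.
  case: (pow_involutive m sK) => E; last by rewrite E mulrC.
  by case: am; rewrite E.
have feC b : fe * cst b = cst b * fe.
  apply: slP => m; rewrite mul_cstE cst_mulE /fe subE /=.
  case: eqP => [am|]; last by rewrite subrr mul0r mulr0.
  case: (pow_involutive m sK) => E; first by rewrite E mulrC.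
  by case: sa; rewrite -E.
have fE : f = fo + fe by rewrite /fe addrC subrK.
have [y [xy yx]] := inverse_exists variable_neq0.
have yT := twisted_inv sK xy yx variable_twisted.
have [fo0|/inverse_exists[v [fov vfo]]] := pselect (fo = 0).
  have [q E1] := twisted_commutator sa variable_twisted.
  have [t E2] := twisted_commutator sa (twisted_commute_mul yT feC).
  by exists (cst a), q, (cst a), t; rewrite -E1 -E2 mulrA xy mul1r fE fo0 add0r.
pose u := a - sigma a.
have u0 : u != 0 by rewrite subr_eq0; apply/eqP => /esym.
have gT : twisted (fo * cst u^-1).
  by apply: twisted_commute_mul => // b; rewrite -!cstM mulrC.
have [q Eg] := twisted_commutator sa gT.
pose p := v * fe.
have pT : twisted p by apply: twisted_commute_mul feC; exact: twisted_inv foT.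
have fgc : f = fo * cst u^-1 * (cst u * p + cst u).
  rewrite -mulrA mulrDr !mulrA -cstM mulVf // cst1 mulrDr !mulr1 mul1r.
  by rewrite /p mulrA fov mul1r addrC.
suff [r [t Ec]] : exists r t, cst u * p + cst u = commutator r t.
  by exists (cst a), q, r, t; rewrite -Eg -Ec.
have [p0|/inverse_exists[w [pw wp]]] := pselect (p = 0).
  exists variable, (cst (- a) * y).
  by rewrite p0 mulr0 add0r twisted_commutator_sub //; exact: variable_twisted.
exists p, (cst (- a) + cst (- a) * w).
rewrite commutatorDr twisted_commutator_sub //; congr (_ + _).
rewrite /commutator pT -mulrBl -cstB rmorphN; congr (cst _ * _).
by rewrite /u; ring.
Qed.

(** * The orbits of the automorphism *)

Lemma pow_multiple i j : pow i =1 id -> pow (j * i) =1 id.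
Proof.
move=> iP b; elim/int_rect: j => [|n IH|n IH]; first by rewrite mul0r.
- by rewrite -addn1 PoszD mulrDl mul1r aut_powD iP.
- have -> : - n.+1%:Z * i = - n%:Z * i - i by lia.
  by rewrite aut_powD (fix_opp (iP b)).
Qed.

Lemma full_orbit_stabilizer (n : nat) b : (0 < n)%N -> pow n =1 id ->
  (forall i : nat, (0 < i < n)%N -> pow i b <> b) ->
  forall m, pow m b = b -> pow m =1 id.
Proof.
move=> n0 nP bP m mb.
have E : m = (m %% n)%Z + (m %/ n)%Z * n by rewrite addrC -divz_eq.
have mE a : pow m a = pow (m %% n)%Z a by rewrite {1}E aut_powD pow_multiple.
have r0 : 0 <= (m %% n)%Z by rewrite modz_ge0 //; lia.
have rn : (m %% n)%Z < n by rewrite ltz_pmod //; lia.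
case: (m %% n)%Z r0 rn mE => // -[|i] _ rn mE a; first by rewrite mE.
by case: (bP i.+1); rewrite -?mE //; lia.
Qed.

(** Suppose that all orbits have at most four elements.  An orbit of length 3
    cannot coexist with one of length 2 or 4: the sum of an element of each kind
    would have an orbit too long.  So all orbit lengths divide 3, or all divide
    4; unless sigma is an involution, any element moved by sigma^2 then has an
    orbit of maximal length. *)
Lemma orbit_cases : [\/ involutive sigma,
  exists a, forall n : nat, (0 < n < 5)%N -> pow n a <> a |
  exists b, (forall m, pow m b = b -> pow m =1 id) /\ pow 2 b <> b].
Proof.
have [sK|nsK] := pselect (involutive sigma); first by constructor 1.
have [ex|nex] :=
  pselect (exists a, forall n : nat, (0 < n < 5)%N -> pow n a <> a).
  by constructor 2.
constructor 3.
have short a : [\/ pow 1 a = a, pow 2 a = a, pow 3 a = a | pow 4 a = a].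
  apply: contrapT => H; apply: nex; exists a => -[|[|[|[|[|n]]]]] // _ E;
    apply: H; by [constructor 1|constructor 2|constructor 3|constructor 4].
have fix1 (i : nat) a : pow 1 a = a -> pow i%:Z a = a.
  by elim: i => // i IH a1; rewrite intS fix_add ?IH.
have [[a [a3 a1]]|no3] := pselect (exists a, pow 3 a = a /\ pow 1 a <> a).
  have P3 : pow 3 =1 id.
    move=> b; apply: contrapT => b3.
    have b4 : pow 4 b = b.
      case: (short b) => // [/(fix1 3%N) //|b2]; exact: (fix_add b2 b2).
    have a4 : pow 4 a <> a by move=> /fix_sub /(_ a3).
    have ab4 : pow 4 (a + b) <> a + b by rewrite rmorphD /= b4 => /addIr.
    case: (short (a + b)) => [/(fix1 4%N) //|ab2|ab3|//].
      exact: (ab4 (fix_add ab2 ab2)).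
    by apply: b3; move: ab3; rewrite rmorphD /= a3 => /addrI.
  exists a; split.
    apply: (@full_orbit_stabilizer 3) => // -[|[|[|i]]] // _.
    by move=> /(fix_sub a3).
  by move=> /(fix_sub a3).
have P4 : pow 4 =1 id.
  move=> b; case: (short b) => [/(fix1 4%N) //|b2|b3|//].
    exact: (fix_add b2 b2).
  by apply: (fix1 4%N); apply: contrapT => b1; apply: no3; exists b.
have [b b2] : exists b, pow 2 b <> b.
  apply: contrapT => H; apply: nsK => b; apply: contrapT => b2.
  by apply: H; exists b.
exists b; split=> //.
apply: (@full_orbit_stabilizer 4) => // -[|[|[|[|i]]]] // _.
  by move/(fix1 2%N).
by move=> /(fix_sub (P4 b)) /(fix1 2%N).
Qed.

End Series.

Theorem mainTheorem1 (k : fieldType) (sigma : {rmorphism k -> k})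
    (sigma_bij : bijective sigma) (sigma_nontrivial : ~ (sigma =1 id))
    (f : skewLaurent sigma_bij) :
  exists p q r t : skewLaurent sigma_bij,
    f = commutator p q * commutator r t.
Proof.
have [f0|/exists_order[s fs flow]] := pselect (f = 0).
  by exists 0, 0, 0, 0; rewrite f0 /commutator !mulr0 subrr mulr0.
case: (orbit_cases sigma_bij) => [sK|[a aP]|[b [bP b2]]].
- have [a sa] : exists a, sigma a <> a.
    apply: contrapT => H; apply: sigma_nontrivial => a; apply: contrapT => sa.
    by apply: H; exists a.
  exact: two_commutators_involution sK sa.
- exact: two_commutators_long_orbit fs flow aP.
- exact: two_commutators_free_orbit fs flow bP b2.
Qed.
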